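(* Let $n$ be an odd natural number greater than two. There exists a nonempty Zariski open subset $\Omega\subset\mathbb{C}^n$ such that if $v\in\Omega$ then $D_{2n}v$ is a full spark frame.
   Context: Coordinates of vectors in $\mathbb{C}^n$ are indexed by $\mathbb{Z}_n=\{0,1,\dots,n-1\}$. Let $T,D\in GL(n,\mathbb{C})$ be the permutation matrices acting by $(Tv)(j)=v((j-1)\bmod n)$ and $(Dv)(j)=v((n-j)\bmod n)$ for $v\in\mathbb{C}^n$, $j\in\mathbb{Z}_n$. $D_{2n}$ is the (dihedral) subgroup of $GL(n,\mathbb{C})$ generated by $T$ and $D$; it has order $2n$ for $n>2$. For $v\in\mathbb{C}^n$, $D_{2n}v=\{gv: g\in D_{2n}\}$ is the orbit of $v$. A set $\mathfrak{F}$ of $m\ge n$ vectors in $\mathbb{C}^n$ is called a full spark frame (or is said to have the Haar property) if every subset of $\mathfrak{F}$ of cardinality $n$ is a basis of $\mathbb{C}^n$. *)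

(* Defs.v *)
From mathcomp Require Export all_boot all_order all_algebra.
From mathcomp Require Export finmap.
From mathcomp Require Export complex mpoly.
From mathcomp Require Export boolp classical_sets cardinality reals.

Set Implicit Arguments.
Unset Strict Implicit.
Unset Printing Implicit Defensive.

Import GRing.Theory.

Local Open Scope classical_set_scope.
Local Open Scope ring_scope.

Section Defs.
Variables (K : fieldType) (n : nat).

(* (T v)(j) = v((j - 1) mod n); [j + n] keeps the nat subtraction exact. *)
Definition shift_mx : 'M[K]_n :=
  \matrix_(j, k) ((k : nat) == (j + n - 1) %% n)%N%:R.

(* (D v)(j) = v((n - j) mod n) *)
Definition refl_mx : 'M[K]_n :=
  \matrix_(j, k) ((k : nat) == (n - j) %% n)%N%:R.

(* The subgroup of GL(n, K) generated by S; meant for S `<=` unitmx, in which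
   case every element of it is in unitmx (see gen_GL_unitmx). *)
Inductive gen_GL (S : set 'M[K]_n) : set 'M[K]_n :=
| gen_GL_sub g : S g -> gen_GL S g
| gen_GL1 : gen_GL S 1%:M
| gen_GLM g h : gen_GL S g -> gen_GL S h -> gen_GL S (g *m h)
| gen_GLV g : gen_GL S g -> gen_GL S (invmx g).

Definition dihedral_GL : set 'M[K]_n := gen_GL [set shift_mx; refl_mx].

Definition orbit_GL (G : set 'M[K]_n) (v : 'cV[K]_n) : set 'cV[K]_n :=
  [set g *m v | g in G].

Definition full_spark_frame (F : set 'cV[K]_n) : Prop :=
  (exists2 m : nat, (n <= m)%N & (F #= `I_m)%card) /\
  (forall B : {fset 'cV[K]_n}, [set` B] `<=` F -> #|` B|%fset = n ->
     basis_of {: 'cV[K]_n}%VS B).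

Definition zariski_closed (Z : set 'cV[K]_n) : Prop :=
  exists P : set {mpoly K[n]},
    Z = [set v | forall p, P p -> p.@[fun i => v i 0] = 0].

Definition zariski_open (U : set 'cV[K]_n) : Prop := zariski_closed (~` U).

Lemma gen_GL_unitmx (S : set 'M[K]_n) :
  (forall g, S g -> g \in unitmx) -> forall g, gen_GL S g -> g \in unitmx.
Proof.
move=> Su g; elim=> {g} [g /Su //||g h _ gu _ hu|g _ gu].
- exact: unitmx1.
- by rewrite unitmx_mul gu.
- by rewrite unitmx_inv.
Qed.

Lemma sel_mxE (f : nat -> nat) (v : 'cV[K]_n) (j k : 'I_n) :
  (k = f j :> nat) ->
  ((\matrix_(a, b) ((b : nat) == f a)%N%:R) *m v) j 0 = v k 0.
Proof.
move=> kE; rewrite mxE (bigD1 k) //= mxE kE eqxx mul1r big1 ?addr0 // => l.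
by move=> lk; rewrite mxE -kE val_eqE (negbTE lk) mul0r.
Qed.

Lemma shift_mxE (v : 'cV[K]_n) (j k : 'I_n) :
  (k = (j + n - 1) %% n :> nat)%N -> (shift_mx *m v) j 0 = v k 0.
Proof. exact: (sel_mxE (f := fun j => (j + n - 1) %% n)%N). Qed.

Lemma refl_mxE (v : 'cV[K]_n) (j k : 'I_n) :
  (k = (n - j) %% n :> nat)%N -> (refl_mx *m v) j 0 = v k 0.
Proof. exact: (sel_mxE (f := fun j => (n - j) %% n)%N). Qed.

Lemma inj_mx_unit (A : 'M[K]_n) :
  (forall v : 'cV[K]_n, A *m v = 0 -> v = 0) -> A \in unitmx.
Proof.
move=> Ai; rewrite -unitmx_tr -row_free_unit; apply/inj_row_free => v vA.
by apply/trmx_inj; rewrite trmx0; apply: Ai; rewrite -[A]trmxK -trmx_mul vA trmx0.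
Qed.

Lemma shift_mx_unit : shift_mx \in unitmx.
Proof.
apply: inj_mx_unit => v Av; apply/matrixP => k l; rewrite ord1 [RHS]mxE.
have n0 : (0 < n)%N by exact: leq_trans (ltn_ord k).
have jn : ((k + 1) %% n < n)%N by rewrite ltn_mod.
rewrite -(@shift_mxE v (Ordinal jn) k) ?Av ?mxE //=.
by rewrite -addnBA // modnDml -addnA subnKC // modnDr modn_small.
Qed.

Lemma refl_mx_unit : refl_mx \in unitmx.
Proof.
apply: inj_mx_unit => v Av; apply/matrixP => k l; rewrite ord1 [RHS]mxE.
have n0 : (0 < n)%N by exact: leq_trans (ltn_ord k).
have jn : ((n - k) %% n < n)%N by rewrite ltn_mod.
rewrite -(@refl_mxE v (Ordinal jn) k) ?Av ?mxE //=.
case: (posnP k) => [-> | k0]; first by rewrite subn0 modnn subn0 modnn.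
by rewrite (modn_small (_ : n - k < n)%N) ?subKn ?modn_small // ?ltn_subrL ?k0 // ltnW.
Qed.

Lemma dihedral_GL_unitmx g : dihedral_GL g -> g \in unitmx.
Proof.
by apply: gen_GL_unitmx => h [] -> ; [exact: shift_mx_unit|exact: refl_mx_unit].
Qed.

End Defs.

(* Main.v *)
Require Import Defs.
From mathcomp Require Import separable cyclic cyclotomic.

(** Every element of the dihedral group acts by v |-> (j |-> v (+-j + a)), so it
    is given by a sign and a translation [a] in Z/n.  The vectors attached to
    [n] distinct such labels are the columns of a square matrix [orbit_mx],
    whose determinant is a polynomial in the coordinates of [v].  Let Omega be
    the set where the product of these determinants, over all injective choices of [n]
    labels, does not vanish.  It is open by construction, and on it every [n]
    vectors of the orbit are independent.  A product of polynomials that each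
    have a nonvanishing point has one too ([meval_neq0_prod]), so Omega is
    nonempty as soon as each single determinant is nonzero somewhere.

    That last fact ([orbit_mx_unit_witness]) is the heart of the proof.  Let
    [w] be a primitive n-th root of unity and write v = sum_k x_k w^(jk).  In
    Fourier coordinates a vanishing combination, with coefficients [c_i], of the
    vectors labelled (sign_i, a_i) says that, for each frequency [k],
<<
      x_k * sum_(i : sign +) c_i y_i^k + x_(-k) * sum_(i : sign -) c_i y_i^k = 0
>>
    where y_i = w^(sign_i a_i).  Since [n] is odd, one sign is borne by [q]
    labels with 2q < n; say it is the sign -.  Choose the spectrum [x] to be 0
    at the frequencies 1, ..., q and 1 elsewhere.  If 1 <= k <= q then x_k = 0,
    whereas x_(-k) = 1 because n - k > q; so the minority sums vanish at [q]
    consecutive exponents, and the Vandermonde argument [power_sums_eq0] kills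
    the [q] minority coefficients.  What is left is that the majority sums
    vanish at the n - q remaining frequencies q + 1, ..., n, which are again
    consecutive because the exponents matter only modulo [n]; there are as many
    of them as majority labels, so the other coefficients vanish as well. *)

Import GRing.Theory Num.Theory.
Local Open Scope ring_scope.
Set Implicit Arguments.
Unset Strict Implicit.
Unset Printing Implicit Defensive.

(** * Roots of unity and power sums *)

(** 'X^n - 1 splits and is separable, so its roots form a multiplicative group
    of order [n]; a finite group of units of a field is cyclic. *)
Lemma prim_root_exists (K : numClosedFieldType) (n : nat) :
  (0 < n)%N -> exists w : K, n.-primitive_root w.
Proof.
move=> n_gt0; have [r Dp] := closed_field_poly_normal ('X^n - 1 : {poly K}).
rewrite (monicP _) ?monicXnsubC // scale1r in Dp.
have rn1 : all n.-unity_root r by apply/allP=> z; rewrite -root_prod_XsubC -Dp.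
have r_size : (n <= size r)%N.
  by rewrite -ltnS -(size_prod_XsubC r id) -Dp size_XnsubC.
suff /hasP[w _ w_prim] : has n.-primitive_root r by exists w.
apply: has_prim_root => //.
by rewrite -separable_prod_XsubC -Dp separable_Xn_sub_1 // pnatr_eq0 -lt0n.
Qed.

(** The Vandermonde argument: the hypothesis extends by linearity from the
    powers of [y i] to all polynomials of size at most #|A|, among them the one
    whose roots are all the other nodes, which isolates [c i].  The shift [s] lets the
    vanishing exponents form any interval. *)
Lemma power_sums_eq0 (K : idomainType) (I : finType) (A : {set I})
    (c y : I -> K) (s : nat) :
  {in A &, injective y} -> {in A, forall i, y i != 0} ->
  (forall k, (k < #|A|)%N -> \sum_(i in A) c i * y i ^+ (s + k) = 0) ->
  {in A, forall i, c i = 0}.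
Proof.
move=> y_inj y_neq0 sum0 i Ai.
pose P := \prod_(j <- enum (A :\ i)) ('X - (y j)%:P).
have P_size : size P = #|A|.
  by rewrite size_prod_XsubC -cardE (cardsD1 i A) Ai.
have : \sum_(j in A) c j * y j ^+ s * P.[y j] = 0.
  rewrite (eq_bigr (fun j => \sum_(k < size P) P`_k * (c j * y j ^+ (s + k)))).
    rewrite exchange_big big1 //= => k _.
    by rewrite -mulr_sumr sum0 ?mulr0 // -P_size.
  move=> j _; rewrite horner_coef mulr_sumr; apply: eq_bigr => k _.
  by rewrite exprD mulrCA !mulrA.
rewrite (bigD1 i) //= big1 ?addr0 => [|j /andP[Aj ji]]; last first.
  suff -> : P.[y j] = 0 by rewrite mulr0.
  rewrite horner_prod big_enum (bigD1 j) ?inE ?ji //= !hornerE subrr.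
  exact: mul0r.
move=> /eqP; rewrite !mulf_eq0 expf_eq0 (negbTE (y_neq0 i Ai)) andbF orbF.
case/orP=> /eqP // /eqP; rewrite horner_prod prodf_seq_eq0 => /hasP[j].
rewrite mem_enum !inE /= !hornerE subr_eq0 => /andP[ji Aj] /eqP yij.
by rewrite (y_inj i j Ai Aj yij) eqxx in ji.
Qed.

(** * The matrices of the dihedral group *)

Section DihedralMatrices.
Variables (K : fieldType) (m : nat).
Local Notation n := m.+2.
Local Notation label := (bool * 'I_n)%type.

Definition flip (b : bool) (j : 'I_n) : 'I_n := if b then - j else j.

Definition dih_act (l : label) (j : 'I_n) : 'I_n := flip l.1 j + l.2.

Definition dih_mx (l : label) : 'M[K]_n :=
  \matrix_(j, k) (k == dih_act l j)%:R.

Lemma mul_dih_mx p (l : label) (v : 'M[K]_(n, p)) j k :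
  (dih_mx l *m v) j k = v (dih_act l j) k.
Proof.
rewrite mxE (bigD1 (dih_act l j)) //= mxE eqxx mul1r big1 ?addr0 // => i.
by move=> /negbTE ni; rewrite mxE ni mul0r.
Qed.

Lemma dih_mx1 : dih_mx (false, 0) = 1%:M.
Proof. by apply/matrixP=> j k; rewrite !mxE /dih_act addr0 eq_sym. Qed.

Lemma dih_mxM l l' :
  dih_mx l *m dih_mx l' = dih_mx (l.1 (+) l'.1, flip l'.1 l.2 + l'.2).
Proof.
apply/matrixP=> j k; rewrite mul_dih_mx !mxE /dih_act addrA; do 3 congr (_ _).
case: l l' => [[] a] [[] b] //=; rewrite /flip /= ?opprD ?opprK //.
Qed.

Lemma dih_mxV l : invmx (dih_mx l) = dih_mx (l.1, - flip l.1 l.2).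
Proof.
have gh1 : dih_mx l *m dih_mx (l.1, - flip l.1 l.2) = 1%:M.
  by rewrite dih_mxM /= addbb subrr dih_mx1.
by rewrite -[LHS]mulmx1 -gh1 mulKmx //; have [] := mulmx1_unit gh1.
Qed.

Lemma shift_dih_mx : shift_mx K n = dih_mx (false, -1).
Proof.
apply/matrixP=> j k; rewrite !mxE -[_ == dih_act _ _]val_eqE /=.
by rewrite -addnBA // subn1 /= modnDmr.
Qed.

Lemma refl_dih_mx : refl_mx K n = dih_mx (true, 0).
Proof.
by apply/matrixP=> j k; rewrite !mxE /dih_act addr0 -[_ == flip _ _]val_eqE.
Qed.

Lemma dihedral_GL_sub g : dihedral_GL g -> exists l, g = dih_mx l.
Proof.
elim=> {g} [g []->||g h _ [l ->] _ [l' ->]|g _ [l ->]].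
- by exists (false, -1); rewrite shift_dih_mx.
- by exists (true, 0); rewrite refl_dih_mx.
- by exists (false, 0); rewrite dih_mx1.
- by rewrite dih_mxM; eexists.
- by rewrite dih_mxV; eexists.
Qed.

(** The generating shift is translation by -1, hence the sign: translation by
    [a] is its power of exponent -a. *)
Lemma dihedral_GL_shift a : dihedral_GL (dih_mx (false, a)).
Proof.
have pow k : dihedral_GL (dih_mx (false, - 1 *+ k)).
  elim: k => [|k IHk]; first by rewrite mulr0n dih_mx1; exact: gen_GL1.
  have -> : dih_mx (false, - 1 *+ k.+1) =
            dih_mx (false, - 1 *+ k) *m shift_mx K n.
    by rewrite shift_dih_mx dih_mxM mulrSr.
  by apply: gen_GLM IHk _; apply: gen_GL_sub; left.
have := pow (- a : 'I_n).
by rewrite mulNrn -[_%:R]/((- a : 'Z_n)%:R) natr_Zp opprK.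
Qed.

End DihedralMatrices.

(** * A vector making given dihedral translates independent *)

Section GenericIndependence.
Variables (K : fieldType) (m : nat).
Local Notation n := m.+2.
Local Notation label := (bool * 'I_n)%type.

Definition orbit_mx (f : {ffun 'I_n -> label}) (v : 'cV[K]_n) : 'M[K]_n :=
  \matrix_(j, i) v (dih_act (f i) j) 0.

Lemma flipK b : involutive (@flip m b).
Proof. by case: b => j; rewrite /flip ?opprK. Qed.

Lemma flipNb b j : flip (~~ b) j = - flip b j :> 'I_n.
Proof. by case: b; rewrite /flip //= opprK. Qed.

Lemma minority_sign (f : 'I_n -> label) : odd n ->
  exists b, (#|[set i | (f i).1 == b]|.*2 < n)%N.
Proof.
move=> n_odd; pose A b := [set i | (f i).1 == b].
have AC : #|A true| + #|A false| = n.
  rewrite -[RHS]card_ord -(cardsC (A true)); congr (_ + #|pred_of_set _|)%N.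
  by apply/setP=> i; rewrite !inE; case: (f i).1.
have [lt_tf|le_ft] := ltnP #|A true| #|A false|.
  by exists true; rewrite -[X in (_ < X)%N]AC -addnn ltn_add2l.
exists false; rewrite ltn_neqAle -[X in _ && (_ <= X)%N]AC -addnn.
rewrite leq_add2r le_ft andbT.
by apply: contraTneq n_odd => <-; rewrite addnn odd_double.
Qed.

Section Fourier.
Variables (w : K) (w_prim : n.-primitive_root w).

Definition chi (a : 'I_n) : K := w ^+ a.

Lemma chiD a b : chi (a + b) = chi a * chi b.
Proof. by rewrite /chi -exprD /= (prim_expr_mod w_prim). Qed.

Lemma chiM a b : chi (a * b) = chi a ^+ b.
Proof. by rewrite /chi -exprM /= (prim_expr_mod w_prim). Qed.

Lemma chi_neq0 a : chi a != 0.
Proof. by rewrite expf_neq0 // (prim_root_eq0 w_prim). Qed.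

Lemma chi_expn a : chi a ^+ n = 1.
Proof. by rewrite /chi exprAC (prim_expr_order w_prim) expr1n. Qed.

Lemma chi_inj : injective chi.
Proof.
move=> a b /eqP; rewrite (eq_prim_root_expr w_prim) !modn_small ?ltn_ord //.
by move=> /eqP /val_inj.
Qed.

(** The Fourier matrix is a square Vandermonde matrix with distinct nodes. *)
Lemma fourier_inj (H : 'I_n -> K) :
  (forall j, \sum_k chi (j * k) * H k = 0) -> forall k, H k = 0.
Proof.
move=> sum0 k; apply: (@power_sums_eq0 _ _ [set: _] H chi 0) => //.
- by move=> a b _ _; exact: chi_inj.
- by move=> a _; exact: chi_neq0.
move=> j; rewrite cardsT card_ord add0n => j_lt.
rewrite -[RHS](sum0 (Ordinal j_lt)); apply: eq_big => [i|i _].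
  by rewrite inE.
by rewrite [_ * i]mulrC chiM mulrC.
Qed.

(** In Fourier coordinates the label (sign, a) multiplies the frequency [k] by
    a character and, when the sign is negative, exchanges the spectral values
    at [k] and [- k]. *)
Lemma fourier_orbit_mx f (x : 'I_n -> K) (c : 'cV[K]_n) j :
  (orbit_mx f (\col_k \sum_l x l * chi (k * l)) *m c) j 0 =
  \sum_k chi (j * k) *
    \sum_i x (flip (f i).1 k) * (c i 0 * chi (flip (f i).1 (f i).2) ^+ k).
Proof.
under [RHS]eq_bigr do rewrite mulr_sumr.
rewrite mxE exchange_big; apply: eq_bigr => i _ /=.
rewrite !mxE mulr_suml (reindex_inj (can_inj (flipK (f i).1))).
apply: eq_bigr => k _; rewrite mulrCA -mulrA; congr (_ * _).
rewrite mulrC mulrCA; congr (_ * _).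
rewrite -chiM -chiD; congr chi.
case: (f i) => [[] a]; rewrite /dih_act /flip /=.
  by rewrite mulrN mulrDl mulNr opprD opprK mulNr.
by rewrite mulrDl.
Qed.

(** The spectrum [x] vanishes on the frequencies 1, ..., q, up to the sign that
    makes it the majority labels that are silenced there. *)
Lemma orbit_mx_unit_witness (f : {ffun 'I_n -> label}) :
  odd n -> injective f -> exists v, orbit_mx f v \in unitmx.
Proof.
move=> n_odd f_inj; have [b] := minority_sign f n_odd.
set A := [set i | _]; set q := #|A| => q_lt.
pose low (k : 'I_n) := (0 < k <= q)%N.
pose x k : K := (~~ low (flip (~~ b) k))%:R.
pose y i := chi (flip (f i).1 (f i).2).
have y_inj s : {in [pred i | (f i).1 == s] &, injective y}.
  move=> i i' /eqP fi /eqP fi' /chi_inj; rewrite fi fi' => /(can_inj (flipK s)).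
  by move=> ff; apply: f_inj; apply: injective_projections; rewrite ?fi ?fi'.
have notinA i : (i \notin A) = ((f i).1 == ~~ b).
  by rewrite inE; case: (f i).1; case: (b).
exists (\col_k \sum_l x l * chi (k * l)); apply: inj_mx_unit => c fc0.
have sum0 k : \sum_i x (flip (f i).1 k) * (c i 0 * y i ^+ k) = 0.
  move: k; apply: fourier_inj => j.
  by rewrite -fourier_orbit_mx fc0 mxE.
(* For 1 <= k <= q only the minority labels contribute. *)
have cA : {in A, forall i, c i 0 = 0}.
  apply: (@power_sums_eq0 _ _ A _ y 1) => [i i'|i _|k k_lt].
  - by rewrite !inE; exact: y_inj.
  - exact: chi_neq0.
  have k1_lt : (1 + k < n)%N.
    rewrite add1n (leq_ltn_trans _ q_lt) // -addnn.
    by rewrite (leq_trans k_lt) ?leq_addr.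
  rewrite -[RHS](sum0 (Ordinal k1_lt)) [RHS](bigID (mem A)) /= [X in _ + X]big1.
    rewrite addr0; apply: eq_bigr => i; rewrite inE => /eqP fi.
    rewrite fi /x flipNb flipK /low /=.
    rewrite (_ : (_ <= q)%N = false) ?andbF ?mul1r //.
    rewrite modn_small ?ltn_subrL //; apply/negbTE; rewrite -ltnNge ltn_subRL.
    by rewrite (leq_ltn_trans _ q_lt) // -addnn leq_add2r.
  move=> i; rewrite notinA => /eqP->.
  by rewrite /x flipK /low /= k_lt mul0r.
(* The remaining frequencies, read as q + 1, ..., n. *)
have cAC : {in ~: A, forall i, c i 0 = 0}.
  apply: (@power_sums_eq0 _ _ (~: A) _ y q.+1) => [i i'|i _|k].
  - by rewrite !finset.in_setC !notinA; exact: y_inj.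
  - exact: chi_neq0.
  rewrite cardsCs finset.setCK card_ord -/q ltn_subRL => k_lt.
  have r_lt : ((q.+1 + k) %% n < n)%N by rewrite ltn_mod.
  have r_high : low (Ordinal r_lt) = false.
    rewrite /low /=; move: k_lt; rewrite leq_eqVlt -addSn => /predU1P[->|k_lt].
      by rewrite modnn.
    by rewrite modn_small // [X in _ && X]leqNgt (@ltn_addr q q.+1 k) /= ?andbF.
  rewrite -[RHS](sum0 (Ordinal r_lt)) [RHS](bigID (mem A)) /= [X in X + _]big1.
    rewrite add0r; apply: eq_big => i; rewrite finset.in_setC //.
    rewrite notinA => /eqP->.
    rewrite /x flipK r_high mul1r; congr (_ * _).
    rewrite [in LHS](divn_eq (q.+1 + k) n) exprD mulnC exprM chi_expn expr1n.
    by rewrite mul1r.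
  by move=> i Ai; rewrite cA // mul0r mulr0.
apply/colP=> i; rewrite mxE; have [/cA //|Ai] := boolP (i \in A).
by apply: cAC; rewrite inE.
Qed.

End Fourier.
End GenericIndependence.

(** * Points where several polynomials do not vanish *)

Section GenericPoint.
Variables (K : numDomainType) (n : nat).

Lemma nonroot_exists (p : {poly K}) : p != 0 -> exists t, p.[t] != 0.
Proof.
move=> p_neq0; apply: contrapT => no_t.
pose ts := [seq k%:R : K | k <- iota 0 (size p)].
suff : (size ts < size p)%N by rewrite size_map size_iota ltnn.
apply: max_poly_roots => //.
  by apply/allP=> t _; apply/negPn/negP => pt; apply: no_t; exists t.
by rewrite map_inj_uniq ?iota_uniq // => i j /eqP; rewrite eqr_nat => /eqP.
Qed.

Lemma restrict_line (p : {mpoly K[n]}) (v w : 'I_n -> K) :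
  exists P : {poly K},
    forall t, P.[t] = p.@[fun i => v i + (w i - v i) * t].
Proof.
exists (mmap polyC (fun i => (v i)%:P + (w i - v i)%:P * 'X) p) => t.
rewrite mevalE /mmap horner_sum; apply: eq_bigr => k _.
rewrite hornerM hornerC; congr (_ * _); rewrite /mmap1 horner_prod.
by apply: eq_bigr => i _; rewrite horner_exp !hornerE.
Qed.

(** On the line through a point where [p] does not vanish and one where [q] does
    not, both restrict to nonzero univariate polynomials, and their product has
    only finitely many roots. *)
Lemma meval_neq0_mul (p q : {mpoly K[n]}) :
  (exists v, p.@[v] != 0) -> (exists v, q.@[v] != 0) ->
  exists v, (p * q).@[v] != 0.
Proof.
move=> [v pv] [w qw].
have [[P PE] [Q QE]] := (restrict_line p v w, restrict_line q v w).
have P_neq0 : P != 0.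
  apply: contraNneq pv => P0; have := PE 0; rewrite P0 horner0 => {1}->.
  by apply/eqP; apply: meval_eq => i; rewrite mulr0 addr0.
have Q_neq0 : Q != 0.
  apply: contraNneq qw => Q0; have := QE 1; rewrite Q0 horner0 => {1}->.
  by apply/eqP; apply: meval_eq => i; rewrite mulr1 subrKC.
have [|t PQt] := @nonroot_exists (P * Q); first by rewrite mulf_neq0.
by exists (fun i => v i + (w i - v i) * t); rewrite mevalM -PE -QE -hornerM.
Qed.

Lemma meval_neq0_prod (I : Type) (r : seq I) (P : pred I)
    (p : I -> {mpoly K[n]}) :
  (forall i, P i -> exists v, (p i).@[v] != 0) ->
  exists v, (\prod_(i <- r | P i) p i).@[v] != 0.
Proof.
move=> p_neq0; elim/big_ind: _ => //; last exact: meval_neq0_mul.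
by exists (fun=> 0); rewrite meval1 oner_neq0.
Qed.

End GenericPoint.

(** * The full spark property *)

Local Open Scope classical_set_scope.

Section FullSpark.
Variables (K : fieldType) (m : nat).
Local Notation n := m.+2.
Local Notation label := (bool * 'I_n)%type.

Definition orbit_det (f : {ffun 'I_n -> label}) : {mpoly K[n]} :=
  \det (\matrix_(j, i) 'X_(dih_act (f i) j)).

Lemma orbit_detE f (v : 'cV[K]_n) :
  (orbit_det f).@[fun i => v i 0] = \det (orbit_mx f v).
Proof.
rewrite /orbit_det -det_map_mx; congr (\det _).
by apply/matrixP=> j i; rewrite !mxE [LHS]mevalXU.
Qed.

Lemma orbit_GL_label (v u : 'cV[K]_n) :
  orbit_GL (@dihedral_GL K n) v u -> exists l, u = dih_mx K l *m v.
Proof. by case=> g /dihedral_GL_sub[l ->] <-; exists l. Qed.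

Lemma free_cols (X : n.-tuple 'cV[K]_n) :
  (\matrix_(j, i) (tnth X i) j 0) \in unitmx -> free X.
Proof.
move=> X_unit; apply/freeP=> k sum0 i.
suff : \col_i k i = 0 by move/colP=> /(_ i); rewrite !mxE.
rewrite -(mulKmx X_unit (\col_i k i)) (_ : _ *m (\col_i k i) = 0) ?mulmx0 //.
rewrite -[RHS]sum0; apply/colP=> j; rewrite mxE summxE.
by apply: eq_bigr => i' _; rewrite !mxE mulrC (tnth_nth 0).
Qed.

Lemma free_orbit (v : 'cV[K]_n) (f : {ffun 'I_n -> label}) :
  \det (orbit_mx f v) != 0 -> free [tuple dih_mx K (f i) *m v | i < n].
Proof.
rewrite -unitfE -unitmxE => fv_unit; apply: free_cols.
rewrite (_ : \matrix_(j, i) _ = orbit_mx f v) //.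
by apply/matrixP=> j i; rewrite !mxE tnth_mktuple mul_dih_mx.
Qed.

(** The pure translates of [v] already supply the [n] distinct vectors that the
    cardinality condition asks for. *)
Lemma full_spark_orbit (v : 'cV[K]_n) :
  (forall f : {ffun 'I_n -> label}, injective f -> \det (orbit_mx f v) != 0) ->
  full_spark_frame (orbit_GL (@dihedral_GL K n) v).
Proof.
move=> det_neq0; set F := orbit_GL _ v; split.
  have F_fin : finite_set F.
    apply: (@sub_finite_set _ _ [set dih_mx K l *m v | l in [set: label]]).
      by move=> u /orbit_GL_label[l ->]; exists l.
    exact/finite_image/finite_finset.
  have [k Fk] := (finite_setP _).1 F_fin; exists k => //.
  rewrite -(card_fset_set Fk).
  pose shift a := dih_mx K (false, a) *m v.
  have shift_inj : injective shift.
    pose f : {ffun 'I_n -> label} := [ffun a => (false, a)].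
    have /det_neq0/free_orbit/free_uniq : injective f.
      by move=> a b; rewrite !ffunE => -[].
    move=> f_uniq; apply/injectiveP; move: f_uniq; congr (is_true (uniq _)).
    by apply: eq_map => a; rewrite ffunE.
  rewrite -[leqLHS](_ : #|` [fset shift a | a in 'I_n]|%fset = _); last first.
    by rewrite card_imfset //= -cardE card_ord.
  apply: fsubset_leq_card; apply/fsubsetP => _ /imfsetP[a _ ->].
  rewrite in_fset_set // inE; exists (dih_mx K (false, a)) => //.
  exact: dihedral_GL_shift.
move=> B BF B_card.
have B_size : size B == n by apply/eqP.
pose X : n.-tuple 'cV[K]_n := Tuple B_size.
have /choice[f fE] : forall i, exists l, tnth X i = dih_mx K l *m v.
  by move=> i; apply/orbit_GL_label/BF; exact: (mem_tnth i X).
rewrite basisEfree; apply/and3P; split; last 1 first.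
- by rewrite dimvf dim_matrix mulr1 B_card.
- have XE : X = [tuple dih_mx K ([ffun i => f i] i) *m v | i < n].
    by apply: eq_from_tnth => i; rewrite tnth_mktuple ffunE.
  rewrite (_ : enum_fset B = X) // XE.
  apply: free_orbit; apply: det_neq0 => i j.
  rewrite !ffunE => fij; apply/(tuple_uniqP X (fset_uniq B)).
  by rewrite !fE fij.
- exact: subvf.
Qed.

End FullSpark.

Theorem corollary2 (R : realType) (n : nat) (hodd : odd n) (hn : (2 < n)%N) :
  exists Omega : set 'cV[R[i]]_n,
    [/\ zariski_open Omega, Omega !=set0
      & forall v : 'cV[R[i]]_n, Omega v ->
          full_spark_frame (orbit_GL (@dihedral_GL R[i] n) v)].
Proof.
case: n hodd hn => [|[|m]] // hodd _.
pose labelling := {ffun 'I_m.+2 -> bool * 'I_m.+2}.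
pose p : {mpoly R[i][m.+2]} :=
  \prod_(f : labelling | injectiveb f) orbit_det _ f.
exists [set v | p.@[fun i => v i 0] != 0]; split.
- exists [set p]; apply/seteqP; split=> v /=.
    by move=> /negP/negPn/eqP pv0 _ ->.
  by move=> /(_ p erefl) ->; rewrite eqxx.
- have [f /injectiveP f_inj|v pv] := @meval_neq0_prod R[i] m.+2 _ (index_enum _)
    (fun f : labelling => injectiveb f) (@orbit_det _ m).
    have [w w_prim] := @prim_root_exists R[i] _ (ltn0Sn m.+1).
    have [v v_unit] := orbit_mx_unit_witness w_prim hodd f_inj.
    by exists (fun i => v i 0); rewrite orbit_detE -unitfE -unitmxE.
  exists (\col_i v i) => /=; rewrite (meval_eq (v2 := v)) // => i.
  by rewrite mxE.
move=> v /= pv; apply: full_spark_orbit => f /injectiveP f_inj.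
rewrite -orbit_detE; apply: contraNneq pv => f0.
by rewrite /p (bigD1 f) //= mevalM f0 mul0r.
Qed.
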